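(* Let $A$ be a positive diagonal $n \times n$ matrix with distinct diagonal entries. Then the algebra generated by $\langle A ]$ is permutation similar to the algebra of all upper triangular $n\times n$ matrices (that is, there is a permutation matrix $P$ such that $P^T \operatorname{alg}(\langle A ]) P$ is the algebra of all upper triangular matrices), and so its dimension is $n(n+1)/2$.
   Context: A matrix is called positive if all its entries are nonnegative real numbers; $M \ge 0$ means that $M$ is positive in this sense. $[A,B] = AB - BA$. For a positive $n\times n$ matrix $A$, the super left-commutant $\langle A ]$ is the collection of all positive $n\times n$ matrices $B$ such that $[A,B] \ge 0$. $\operatorname{alg}(\mathcal{F})$ denotes the algebra (over $\mathbb{C}$) generated by a family $\mathcal{F}$ of complex $n\times n$ matrices. *)

(* Defs.v *)
From HB Require Import structures.
From mathcomp Require Import all_boot all_order all_algebra.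
From mathcomp Require Import all_classical all_reals.
From mathcomp Require Export complex.

Set Implicit Arguments.
Unset Strict Implicit.
Unset Printing Implicit Defensive.

Import Order.TTheory GRing.Theory Num.Theory.

Local Open Scope classical_set_scope.
Local Open Scope ring_scope.

(* Over C := R[i], [0 <= z] holds iff z is a nonnegative real number. *)
Definition mx_positive (C : numDomainType) (n : nat) (M : 'M[C]_n) : Prop :=
  forall i j, 0 <= M i j.

Definition mx_commutator (C : pzRingType) (n : nat) (A B : 'M[C]_n) : 'M[C]_n :=
  A *m B - B *m A.

Definition super_left_commutant (C : numDomainType) (n : nat) (A : 'M[C]_n) :
    set 'M[C]_n :=
  [set B | mx_positive B /\ mx_positive (mx_commutator A B)].

(* Subalgebras are not required to contain 1%:M; this makes no difference for
   the algebra generated by a family that already contains 1%:M, such as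
   super_left_commutant A. *)
Definition mx_subalgebra (C : pzRingType) (n : nat) (S : set 'M[C]_n) : Prop :=
  [/\ S 0,
      forall M N, S M -> S N -> S (M + N),
      forall (c : C) M, S M -> S (c *: M) &
      forall M N, S M -> S N -> S (M *m N)].

Definition mx_alg (C : pzRingType) (n : nat) (F : set 'M[C]_n) : set 'M[C]_n :=
  smallest (@mx_subalgebra C n) F.

(* [is_trig_mx] is lower triangularity. *)
Definition upper_triangular (C : pzRingType) (n : nat) : set 'M[C]_n :=
  [set M | is_trig_mx M^T].

Definition perm_similar (C : pzRingType) (n : nat) (S T : set 'M[C]_n) : Prop :=
  exists2 P : 'M[C]_n, is_perm_mx P & [set P^T *m M *m P | M in S] = T.

Definition has_dim (C : fieldType) (n : nat) (S : set 'M[C]_n) (d : nat) : Prop :=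
  exists2 V : {vspace 'M[C]_n}, S = [set` V] & \dim V = d.

(* Main.v *)
(** Entrywise, [A, B]_ij = (A_ii - A_jj) B_ij, so [super_left_commutant A]
    consists of the positive matrices vanishing at all (i, j) with
    A_ii < A_jj. The matrices vanishing there form an algebra, spanned by the
    matrix units it contains, all of which lie in [super_left_commutant A].
    Sorting the diagonal in decreasing order carries this pattern to the upper
    triangular one. *)
Require Import Defs.
From mathcomp Require Import all_boot all_order all_algebra all_fingroup.
From mathcomp Require Import all_classical all_reals.

Set Implicit Arguments.
Unset Strict Implicit.
Unset Printing Implicit Defensive.

Import Order.TTheory GRing.Theory Num.Theory.

Local Open Scope ring_scope.
Local Open Scope complex_scope.

Definition supported_on (C : pzRingType) (n : nat) (S : {set 'I_n * 'I_n}) :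
    set 'M[C]_n :=
  [set M | forall i j, (i, j) \notin S -> M i j = 0]%classic.

(** The matrix units at the positions in [S], enumerated by [enum_val], form a basis. *)
Lemma has_dim_supported_on (C : fieldType) (n : nat) (S : {set 'I_n * 'I_n}) :
  has_dim (@supported_on C n S) #|S|.
Proof.
pose E (p : 'I_n * 'I_n) : 'M[C]_n := delta_mx p.1 p.2.
pose X := [tuple E (enum_val k) | k < #|S|].
have XE (k : 'I_#|S|) : X`_k = E (enum_val k).
  by rewrite -tnth_nth tnth_mktuple.
have E_neq p i j : (i, j) != p -> E p i j = 0.
  by case: p => a b; rewrite mxE /= xpair_eqE => /negbTE ->.
have freeX : free X.
  (* Reading the vanishing combination at the position of the [k]-th unit isolates [c k]. *)
  apply/freeP => c c0 k; have := congr1 (fun M : 'M_n =>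
    M (enum_val k).1 (enum_val k).2) c0.
  rewrite summxE mxE (bigD1 k) //= mxE XE !mxE !eqxx mulr1.
  rewrite big1 ?addr0 // => l lk; rewrite mxE XE E_neq ?mulr0 //.
  by rewrite -surjective_pairing (inj_eq enum_val_inj) eq_sym.
exists <<X>>%VS; last by rewrite (eqP freeX) size_tuple.
apply/seteqP; split => M /=.
- move=> M0; rewrite (matrix_sum_delta M).
  apply: memv_suml => i _; apply: memv_suml => j _.
  have [ijS|/M0 ->] := boolP ((i, j) \in S); last by rewrite scale0r mem0v.
  apply/memvZ/memv_span; apply/(tnthP X); exists (enum_rank_in ijS (i, j)).
  by rewrite tnth_mktuple enum_rankK_in.
- move=> /(@coord_span _ _ _ X) -> i j ijS; rewrite summxE big1 // => k _.
  rewrite mxE XE E_neq ?mulr0 //.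
  by apply: contraNneq ijS => ->; apply: enum_valP.
Qed.

(** The graph and its transpose cover all pairs by totality and meet exactly in the diagonal by
    antisymmetry and reflexivity, so twice the cardinality is n^2 + n. *)
Lemma card_total_order_graph (n : nat) (r : rel 'I_n) :
  reflexive r -> antisymmetric r -> total r ->
  #|[set p : 'I_n * 'I_n | r p.1 p.2]| = ((n * n.+1) %/ 2)%N.
Proof.
move=> rr ra rt; set S := [set _ | _].
pose sw (p : 'I_n * 'I_n) := (p.2, p.1).
have swK : involutive sw by case.
have cS : #|sw @: S| = #|S| by apply/card_imset/inv_inj.
have swE p : (p \in sw @: S) = r p.2 p.1.
  by rewrite -{1}(swK p) (mem_imset _ _ (inv_inj swK)) inE.
have /esym := cardsUI S (sw @: S).
have -> : S :|: sw @: S = [set: 'I_n * 'I_n].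
  by apply/setP => p; rewrite finset.in_setU swE !inE rt.
have -> : S :&: sw @: S = [set (i, i) | i : 'I_n].
  apply/setP => -[i j]; rewrite finset.in_setI swE !inE /=.
  apply/idP/imsetP => [/ra ->|[k _ [-> ->]]]; first by exists j.
  by rewrite rr.
rewrite (card_imset _ (_ : injective (fun i : 'I_n => (i, i)))); last by move=> i j [].
rewrite cS cardsT card_prod !card_ord addnn => e.
by rewrite mulnS addnC -e -muln2 mulnK.
Qed.

Lemma commutator_diag_mxE (C : comPzRingType) (n : nat) (A B : 'M[C]_n) i j :
  is_diag_mx A -> mx_commutator A B i j = (A i i - A j j) * B i j.
Proof.
move=> /is_diag_mxP A0; rewrite !mxE (bigD1 i) //= big1 ?addr0; last first.
  by move=> k ki; rewrite A0 ?mul0r // eq_sym.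
rewrite (bigD1 j) //= big1 ?addr0; last by move=> k kj; rewrite A0 ?mulr0.
by rewrite mulrBl [B i j * _]mulrC.
Qed.

Section DiagonalSuperCommutant.
Variables (C : numDomainType) (n : nat) (A : 'M[C]_n).
Hypotheses (A_pos : mx_positive A) (A_diag : is_diag_mx A).

Definition diag_ge : {set 'I_n * 'I_n} := [set p | A p.2 p.2 <= A p.1 p.1].

(** The order on [C] is only partial; nonnegative elements are real, hence comparable. *)
Lemma diag_comparable i j : A i i >=< A j j.
Proof. by apply: real_comparable; rewrite ger0_real. Qed.

Lemma notin_diag_ge i j : ((i, j) \notin diag_ge) = (A i i < A j j).
Proof. by rewrite inE /= -comparable_ltNge // diag_comparable. Qed.

(** A negative factor A_ii - A_jj turns nonnegativity of the commutator into B_ij <= 0, while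
    positivity of B gives B_ij >= 0. *)
Lemma super_left_commutant_sub :
  (super_left_commutant A `<=` supported_on diag_ge)%classic.
Proof.
move=> B [B0 AB0] i j; rewrite notin_diag_ge => lt_ij.
have := AB0 i j; rewrite commutator_diag_mxE // nmulr_rge0 ?subr_lt0 // => Bij.
by apply/le_anti; rewrite Bij B0.
Qed.

Lemma delta_super_left_commutant i j :
  (i, j) \in diag_ge -> super_left_commutant A (delta_mx i j).
Proof.
rewrite inE /= => le_ji; split=> k l; rewrite ?commutator_diag_mxE // mxE.
  exact: ler0n.
by case: eqP => [->|_]; case: eqP => [->|_] /=; rewrite ?mulr0 // mulr1 subr_ge0.
Qed.

Lemma mx_subalgebra_supported_on : mx_subalgebra (@supported_on C n diag_ge).
Proof.
split=> [i j _|M N M0 N0 i j ij|c M M0 i j ij|M N M0 N0 i j ij]; rewrite mxE //.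
- by rewrite M0 ?N0 ?addr0.
- by rewrite M0 ?mulr0.
(* By transitivity, if (i, j) lies outside [diag_ge], then for each k so does (i, k) or (k, j), and
   every term of the product's entry vanishes. *)
apply: big1 => k _; have [ik|/M0 ->] := boolP ((i, k) \in diag_ge);
  last by rewrite mul0r.
rewrite N0 ?mulr0 //; apply: contra ij; rewrite !inE /= in ik * => kj.
exact: le_trans kj ik.
Qed.

Lemma mx_alg_super_left_commutant :
  mx_alg (super_left_commutant A) = supported_on diag_ge.
Proof.
apply/seteqP; split.
  apply: smallest_sub; first exact: mx_subalgebra_supported_on.
  exact: super_left_commutant_sub.
move=> M M0 T [[T0 TD TZ _] sT]; rewrite (matrix_sum_delta M).
apply: (big_ind T) => // i _; apply: (big_ind T) => // j _.
have [ij|/M0 ->] := boolP ((i, j) \in diag_ge); last by rewrite scale0r.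
exact/TZ/sT/delta_super_left_commutant.
Qed.

Hypothesis A_dist : injective (fun i : 'I_n => A i i).

Lemma sort_diag :
  exists s : 'S_n, forall i j : 'I_n, ((s i, s j) \notin diag_ge) = (j < i)%N.
Proof.
(* The rank of [i] is the number of diagonal entries strictly above its own. Distinct entries have
   distinct ranks, so ranking is a permutation; its inverse lists the indices by decreasing
   entry. *)
pose U i := [set j | A i i < A j j].
have U_lt i j : A i i < A j j -> (#|U j| < #|U i|)%N.
  move=> ij; apply/proper_card/properP; split.
    by apply/fintype.subsetP => k; rewrite !inE; apply: lt_trans.
  by exists j; rewrite !inE ?ltxx.
have r_lt i : (#|U i| < n)%N.
  rewrite -[X in (_ < X)%N]card_ord -cardsT; apply/proper_card/properP.
  by split; [exact: finset.subsetT | exists i; rewrite !inE ?ltxx].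
pose r i := Ordinal (r_lt i).
have r_inj : injective r.
  move=> i j [] Uij; apply: A_dist => /=.
  by case: (comparable_ltgtP (diag_comparable i j)) => // /U_lt;
    rewrite Uij ltnn.
set p := perm r_inj; exists p^-1%g => i j.
rewrite -{2}(permKV p i) -{2}(permKV p j).
move: (p^-1%g i) (p^-1%g j) => {}i {}j; rewrite !permE notin_diag_ge /=.
case: (comparable_ltgtP (diag_comparable i j)) => [/U_lt -> //|/U_lt ji|/A_dist ->].
  by rewrite ltnNge ltnW.
by rewrite ltnn.
Qed.

Lemma perm_similar_diag_ge :
  perm_similar (@supported_on C n diag_ge) (@upper_triangular C n).
Proof.
have [s sP] := sort_diag.
have conjE (Q : 'S_n) (M : 'M[C]_n) i j :
    (perm_mx Q *m M *m (perm_mx Q)^T) i j = M (Q i) (Q j).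
  by rewrite tr_perm_mx -col_permE -row_permE !mxE.
(* With this transpose as P, [conjE] shows that P^T M P has entries M (s i) (s j), which [sort_diag]
   makes vanish below the diagonal. *)
exists (perm_mx s)^T; first by rewrite tr_perm_mx perm_mx_is_perm.
rewrite trmxK; apply/seteqP; split => [_ [M M0 <-]|N /= /is_trig_mxP N0].
  by apply/is_trig_mxP => i j ij; rewrite mxE conjE M0 // sP.
(* The preimage of [N] is its conjugate by the inverse permutation. *)
exists (perm_mx s^-1 *m N *m (perm_mx s^-1)^T).
  move=> i j; rewrite -{1}(permKV s i) -{1}(permKV s j) sP conjE => ij.
  by have := N0 _ _ ij; rewrite mxE.
by apply/matrixP => i j; rewrite !conjE !permK.
Qed.

(** Distinctness of the diagonal entries makes the comparison of entries antisymmetric on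
    indices. *)
Lemma card_diag_ge : #|diag_ge| = ((n * n.+1) %/ 2)%N.
Proof.
apply: (@card_total_order_graph n (fun i j => A j j <= A i i)).
- by move=> i.
- by move=> i j /le_anti /A_dist.
- by move=> i j; have := diag_comparable j i; rewrite /Order.comparable.
Qed.

End DiagonalSuperCommutant.

Theorem theorem3p5 (R : realType) (n : nat) (A : 'M[R[i]]_n)
    (A_pos : mx_positive A) (A_diag : is_diag_mx A)
    (A_dist : injective (fun i : 'I_n => A i i)) :
  perm_similar (mx_alg (super_left_commutant A)) (@upper_triangular R[i] n) /\
  has_dim (mx_alg (super_left_commutant A)) ((n * n.+1) %/ 2)%N.
Proof.
rewrite mx_alg_super_left_commutant //; split; first exact: perm_similar_diag_ge.
by rewrite -(card_diag_ge A_pos A_dist); apply: has_dim_supported_on.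
Qed.
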